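(* Let $\mathcal{M}$ be a Minsky machine satisfying the standing assumptions below, let $R\le\mathbb{A}(\mathcal{M})^m$ be computational and non-halting, and let $\mathcal{N}(R)$ be its inherently non-halting part. Let $\alpha\in Y^m$ be such that $\alpha(\neq i)\in R(\neq i)$ for all $i\in[m]$, and suppose there are distinct $k,\ell\notin\mathcal{N}(R)$ such that $\alpha(\neq k)\in R_I(\neq k)$ and $\alpha(\neq\ell)\in R_I(\neq\ell)$. Then $\alpha\in R_I$.
   Context: Minsky machines. A Minsky machine $\mathcal{M}$ has states $\{0,1,\dots,N\}$ ($0$ is the halting state, $1$ the initial state), two registers $A,B$ holding values in $\mathbb{N}$, and a finite set of instructions of the forms $(i,R,j)$ and $(i,R,k,j)$ with $R\in\{A,B\}$. It acts on configurations $(s,\alpha,\beta)\in\{0,\dots,N\}\times\mathbb{N}\times\mathbb{N}$: $\mathcal{M}(i,\alpha,\beta)$ is $(j,\alpha+1,\beta)$ if $(i,A,j)\in\mathcal{M}$; $(j,\alpha,\beta+1)$ if $(i,B,j)\in\mathcal{M}$; $(j,\alpha-1,\beta)$ if $(i,A,k,j)\in\mathcal{M}$ and $\alpha\neq0$; $(j,\alpha,\beta-1)$ if $(i,B,k,j)\in\mathcal{M}$ and $\beta\ne 0$; $(k,\alpha,\beta)$ if $(i,A,k,j)\in\mathcal{M}$ and $\alpha=0$, or $(i,B,k,j)\in\mathcal{M}$ and $\beta=0$; and $(0,\alpha,\beta)$ if $i=0$. $\mathcal{M}$ halts if $\mathcal{M}^n(1,0,0)$ has state $0$ for some $n$. Standing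 assumptions on $\mathcal{M}$: it returns both registers to $0$ before halting; it has exactly one instruction $(i,\dots)$ for each non-halting state $i$; the instruction for state $1$ has the form $(1,R,s)$; in the state graph (vertices the states, an edge $i\to j$ iff $\mathcal{M}(i,\alpha,\beta)=(j,\alpha',\beta')$ for some $\alpha,\beta,\alpha',\beta'$) every state is reachable from $1$ and $0$ is reachable from every state; and $\mathcal{M}$ halts with capacity $\kappa$ (it halts and $\alpha+\beta\le\kappa$ whenever $\mathcal{M}^n(1,0,0)=(i,\alpha,\beta)$). The algebra. $A(\mathcal{M})=\{\langle i,c\rangle: 0\le i\le N,\ c\in\{\bullet,\times,0,A,B\}\}$. Put $X=\{\langle i,\times\rangle\}$, $D=\{\langle i,\bullet\rangle\}$, $C=A(\mathcal{M})\setminus(X\cup D)$, $Y=A(\mathcal{M})\setminus X$; $\mathrm{X}(\langle i,c\rangle)=\langle i,\times\rangle$, $\mathrm{State}(\langle i,c\rangle)=i$, $\mathrm{Content}(\langle i,c\rangle)=c$. Write ''$(i,R,\dots,j)\in\mathcal{M}$'' to mean $(i,R,j)\in\mathcal{M}$ or $(i,R,k,j)\in\mathcal{M}$ for some $k$. The operations (cases read in order, first applicable case applies): $\langle i,c\rangle\wedge\langle j,d\rangle$ is $\langle i,c\rangle$ if the two are equal, else $\langle\min(i,j),\times\rangle$. $M(x,y)$: $\langle j,R\rangle$ if $x=\langle i,\bullet\rangle, y=\langle i,0\rangle,(i,R,j)\in\mathcal{M}$; $\langle j,0\rangle$ if $x=\langle i,\bullet\rangle,y=\langle i,R\rangle,(i,R,k,j)\in\mathcal{M}$;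 $\langle j,\bullet\rangle$ if $x=\langle i,0\rangle,y=\langle i,\bullet\rangle,(i,R,j)\in\mathcal{M}$; $\langle j,\bullet\rangle$ if $x=\langle i,R\rangle,y=\langle i,\bullet\rangle,(i,R,k,j)\in\mathcal{M}$; $\langle j,c\rangle$ if $x=y=\langle i,c\rangle$, $c\ne\bullet$, $(i,R,\dots,j)\in\mathcal{M}$; $\langle j,\times\rangle$ if $\mathrm{State}(x)=\mathrm{State}(y)=i$ and $(i,R,\dots,j)\in\mathcal{M}$; otherwise $\mathrm{X}(y)$. $M'(x)$: $\langle k,c\rangle$ if $x=\langle i,c\rangle$, $(i,R,k,j)\in\mathcal{M}$, $c\neq R$; $\langle k,\times\rangle$ if $\mathrm{State}(x)=i$ and $(i,R,k,j)\in\mathcal{M}$; otherwise $\mathrm{X}(x)$. $I(x,y)$: $\langle1,\bullet\rangle$ if $x\in D$; $\langle 1,0\rangle$ if $y\in C$; otherwise $\langle1,\times\rangle$. $H(x)$: $\langle0,0\rangle$ if $x\in\{\langle0,0\rangle,\langle0,\bullet\rangle\}$, otherwise $\langle0,\times\rangle$. $N_0(x,y,z)$: $y$ if $x=\langle0,\bullet\rangle$ and $\mathrm{State}(y)=\mathrm{State}(z)$; $z$ if $x=\langle0,0\rangle$, $z\notin D$, $\mathrm{State}(y)=\mathrm{State}(z)$; otherwise $\mathrm{X}(y\wedge z)$. $S(x,y,z)$: $\langle1,0\rangle$ if $x=\langle1,0\rangle$, $\mathrm{State}(y)=\mathrm{State}(z)=1$ and $(\mathrm{Content}(y),\mathrm{Content}(z))\in\{(\bullet,0),(0,\bullet),(0,0)\}$;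 otherwise $\langle1,\times\rangle$. $N_\bullet(u,x,y,z)$, where the first four cases require $\mathrm{State}(x)=\mathrm{State}(y)=\mathrm{State}(z)$: $x$ if $x=y\notin X$; $x$ if $u\in D$, $y\in X$; $y$ if $u\in D$, $x\in X$; $z$ if $u\in D$, $z\in\{x,y\}$; otherwise $\mathrm{X}(x\wedge y\wedge z)$. $P(u,v,x,y)$: $x$ if $\mathrm{State}(u)=\mathrm{State}(v)$, else $y$. $\mathbb{A}(\mathcal{M})=\langle A(\mathcal{M});\wedge,M,M',I,H,N_0,S,N_\bullet,P\rangle$; operations act coordinatewise on powers; $R\le\mathbb{A}(\mathcal{M})^m$ means $R$ is a subuniverse of $A(\mathcal{M})^m$. Notation and relation notions. For $a\in A(\mathcal{M})^m$ and $J\subseteq[m]$, $a(J)$ is the projection to coordinates $J$, $R(J)$ the projection of $R$, and $a(\neq i)=a([m]\setminus\{i\})$, $R(\neq i)=R([m]\setminus\{i\})$. A tuple is synchronized if its entries all have the same state. $R$ is computational if all its elements are synchronized and each has at most one coordinate in $D$. $R$ (of any arity $p$) is halting if it contains some $r\in\{\langle0,0\rangle,\langle0,\bullet\rangle\}^p\setminus\{\langle0,0\rangle\}^p$, non-halting otherwise. For computational $R$: $\mathcal{D}(R)=\{i\in[m]:R(i)\cap D\ne\emptyset\}$. $R_I$ is the subuniverse of $A(\mathcal{M})^m$ generated by $\{I(a,b):a,b\in R\cap Y^m\}$. For computational non-halting $R$, $\mathcal{N}(R)$ denotes a fixed subset $\mathcal{N}\subseteq[m]$ such that $R(\mathcal{N})$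 is non-halting, $|\mathcal{N}\cap\mathcal{D}(R)|\le\kappa$, $\mathcal{N}\cap\mathcal{D}(R)\ne\emptyset$ whenever $\mathcal{D}(R)\ne\emptyset$, and $[m]\setminus\mathcal{D}(R)\subseteq\mathcal{N}$ (such a set exists). Standing assumption: the subalgebra of $\mathbb{A}(\mathcal{M})$ generated by $\{\langle1,\bullet\rangle,\langle1,0\rangle\}$ contains $\langle0,\bullet\rangle$. *)

(* Defs.v *)
From HB Require Import structures.
From mathcomp Require Import all_boot.
From Stdlib Require Import Relation_Operators.

Set Implicit Arguments.
Unset Strict Implicit.
Unset Printing Implicit Defensive.

Inductive register := RegA | RegB.

Definition bool_of_register (r : register) : bool :=
  if r is RegA then true else false.
Definition register_of_bool (b : bool) : register := if b then RegA else RegB.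
Lemma bool_of_registerK : cancel bool_of_register register_of_bool.
Proof. by case. Qed.
HB.instance Definition _ := Finite.copy register (can_type bool_of_registerK).

(* [state n] is {0, ..., N} with N = n.+1: the initial state 1 has to exist,
   so N >= 1. *)
Definition state (n : nat) := 'I_n.+2.
Definition st0 {n : nat} : state n := ord0.
Definition st1 {n : nat} : state n := @Ordinal n.+2 1 isT.

(* [Inc i R j] is (i, R, j) and [Dec i R k j] is (i, R, k, j); k is the target
   of the zero test. *)
Inductive instr (n : nat) :=
  | Inc of state n & register & state n
  | Dec of state n & register & state n & state n.

Definition instr_code n (t : instr n) :
    (state n * register * state n) +
    (state n * register * state n * state n) :=
  match t with
  | Inc i r j => inl (i, r, j)
  | Dec i r k j => inr (i, r, k, j)
  end.
Definition instr_decode n (t : (state n * register * state n) +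
    (state n * register * state n * state n)) : instr n :=
  match t with
  | inl (i, r, j) => Inc i r j
  | inr (i, r, k, j) => Dec i r k j
  end.
Lemma instr_codeK n : cancel (@instr_code n) (@instr_decode n).
Proof. by case. Qed.
HB.instance Definition _ n := Finite.copy (instr n) (can_type (@instr_codeK n)).

Definition source n (t : instr n) : state n :=
  match t with Inc i _ _ => i | Dec i _ _ _ => i end.

Definition machine (n : nat) := {set instr n}.

Definition instrs_from n (M : machine n) (i : state n) : {set instr n} :=
  [set t in M | source t == i].

(* A set of instructions acts as a function on configurations only if no state
   is the source of two instructions and the halting state, where the action is
   the identity, is the source of none. *)
Definition one_instr_per_state n (M : machine n) : Prop :=
  instrs_from M st0 = set0 /\
  forall i : state n, i != st0 -> #|instrs_from M i| = 1.

(* The instruction with source [i]; meaningful under [one_instr_per_state]. *)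
Definition instr_at n (M : machine n) (i : state n) : option (instr n) :=
  [pick t in instrs_from M i].

Definition config (n : nat) := (state n * nat * nat)%type.

Definition step n (M : machine n) (c : config n) : config n :=
  let: (s, a, b) := c in
  if s == st0 then c else
  match instr_at M s with
  | Some (Inc _ RegA j) => (j, a.+1, b)
  | Some (Inc _ RegB j) => (j, a, b.+1)
  | Some (Dec _ RegA k j) => if a == 0 then (k, a, b) else (j, a.-1, b)
  | Some (Dec _ RegB k j) => if b == 0 then (k, a, b) else (j, a, b.-1)
  | None => c
  end.

Definition run n (M : machine n) (t : nat) : config n :=
  iter t (step M) (st1, 0, 0).

Definition halts n (M : machine n) : Prop :=
  exists t a b, run M t = (st0, a, b).

Definition halts_with_capacity n (M : machine n) (kappa : nat) : Prop :=
  halts M /\ forall t i a b, run M t = (i, a, b) -> a + b <= kappa.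

Definition edge n (M : machine n) (i j : state n) : Prop :=
  exists a b a' b' : nat, step M (i, a, b) = (j, a', b').

Definition reachable n (M : machine n) : state n -> state n -> Prop :=
  clos_refl_trans (state n) (edge M).

Record standing n (M : machine n) (kappa : nat) : Prop := Standing {
  standing_instr : one_instr_per_state M;
  standing_registers : forall t a b,
    run M t = (st0, a, b) -> a = 0 /\ b = 0;
  standing_start : exists r s, Inc st1 r s \in M;
  standing_from1 : forall i, reachable M st1 i;
  standing_to0 : forall i, reachable M i st0;
  standing_capacity : halts_with_capacity M kappa
}.

(* Dot is the bullet, Cross the content of the elements of X. *)
Inductive content := Dot | Cross | Zero | Reg of register.

Definition content_code (c : content) : option (option (option register)) :=
  match c with
  | Dot => None
  | Cross => Some None
  | Zero => Some (Some None)
  | Reg r => Some (Some (Some r))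
  end.
Definition content_decode (c : option (option (option register))) : content :=
  match c with
  | None => Dot
  | Some None => Cross
  | Some (Some None) => Zero
  | Some (Some (Some r)) => Reg r
  end.
Lemma content_codeK : cancel content_code content_decode.
Proof. by case. Qed.
HB.instance Definition _ := Finite.copy content (can_type content_codeK).

Definition elt (n : nat) := (state n * content)%type.

Definition State n (x : elt n) : state n := x.1.
Definition Content n (x : elt n) : content := x.2.
Definition toX n (x : elt n) : elt n := (State x, Cross).

Definition setX_ {n : nat} : {set elt n} := [set x | Content x == Cross].
Definition setD_ {n : nat} : {set elt n} := [set x | Content x == Dot].
Definition setC_ {n : nat} : {set elt n} := ~: (setX_ :|: setD_).
Definition setY_ {n : nat} : {set elt n} := ~: setX_.

Definition st_min n (i j : state n) : state n := if i <= j then i else j.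

Section Operations.
Variables (n : nat) (M : machine n).
Implicit Types u v x y z : elt n.

Definition op_meet x y : elt n :=
  if x == y then x else (st_min (State x) (State y), Cross).

Definition op_M x y : elt n :=
  if State x != State y then toX y else
  match instr_at M (State x) with
  | Some (Inc _ r j) =>
      if (Content x == Dot) && (Content y == Zero) then (j, Reg r)
      else if (Content x == Zero) && (Content y == Dot) then (j, Dot)
      else if (x == y) && (Content x != Dot) then (j, Content x)
      else (j, Cross)
  | Some (Dec _ r _ j) =>
      if (Content x == Dot) && (Content y == Reg r) then (j, Zero)
      else if (Content x == Reg r) && (Content y == Dot) then (j, Dot)
      else if (x == y) && (Content x != Dot) then (j, Content x)
      else (j, Cross)
  | None => toX y
  end.

Definition op_M' x : elt n :=
  match instr_at M (State x) with
  | Some (Dec _ r k _) =>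
      if Content x != Reg r then (k, Content x) else (k, Cross)
  | _ => toX x
  end.

Definition op_I x y : elt n :=
  if x \in setD_ then (st1, Dot)
  else if y \in setC_ then (st1, Zero)
  else (st1, Cross).

Definition op_H x : elt n :=
  if (x == (st0, Zero)) || (x == (st0, Dot)) then (st0, Zero)
  else (st0, Cross).

Definition op_N0 x y z : elt n :=
  if (x == (st0, Dot)) && (State y == State z) then y
  else if [&& x == (st0, Zero), z \notin setD_ & State y == State z] then z
  else toX (op_meet y z).

Definition op_S x y z : elt n :=
  if [&& x == (st1, Zero), State y == st1, State z == st1 &
         (Content y, Content z) \in [:: (Dot, Zero); (Zero, Dot); (Zero, Zero)]]
  then (st1, Zero) else (st1, Cross).

Definition op_Ndot u x y z : elt n :=
  let same := (State x == State y) && (State y == State z) in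
  if [&& same, x == y & x \notin setX_] then x
  else if [&& same, u \in setD_ & y \in setX_] then x
  else if [&& same, u \in setD_ & x \in setX_] then y
  else if [&& same, u \in setD_ & (z == x) || (z == y)] then z
  else toX (op_meet (op_meet x y) z).

Definition op_P u v x y : elt n := if State u == State v then x else y.

End Operations.

Record ops (U : Type) := Ops {
  o_meet : U -> U -> U;
  o_M : U -> U -> U;
  o_M' : U -> U;
  o_I : U -> U -> U;
  o_H : U -> U;
  o_N0 : U -> U -> U -> U;
  o_S : U -> U -> U -> U;
  o_Ndot : U -> U -> U -> U -> U;
  o_P : U -> U -> U -> U -> U
}.

Definition alg n (M : machine n) : ops (elt n) :=
  {| o_meet := @op_meet n;
     o_M := op_M M;
     o_M' := op_M' M;
     o_I := @op_I n;
     o_H := @op_H n;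
     o_N0 := @op_N0 n;
     o_S := @op_S n;
     o_Ndot := @op_Ndot n;
     o_P := @op_P n |}.

Definition power (U : Type) (o : ops U) (T : finType) : ops {ffun T -> U} :=
  let V := {ffun T -> U} in
  {| o_meet := fun x y : V => [ffun i => o_meet o (x i) (y i)];
     o_M := fun x y : V => [ffun i => o_M o (x i) (y i)];
     o_M' := fun x : V => [ffun i => o_M' o (x i)];
     o_I := fun x y : V => [ffun i => o_I o (x i) (y i)];
     o_H := fun x : V => [ffun i => o_H o (x i)];
     o_N0 := fun x y z : V => [ffun i => o_N0 o (x i) (y i) (z i)];
     o_S := fun x y z : V => [ffun i => o_S o (x i) (y i) (z i)];
     o_Ndot := fun u x y z : V =>
       [ffun i => o_Ndot o (u i) (x i) (y i) (z i)];
     o_P := fun u v x y : V =>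
       [ffun i => o_P o (u i) (v i) (x i) (y i)] |}.

Definition subuniverse (U : finType) (o : ops U) (R : {set U}) : bool :=
  [&& [forall x in R, forall y in R, o_meet o x y \in R],
      [forall x in R, forall y in R, o_M o x y \in R],
      [forall x in R, o_M' o x \in R],
      [forall x in R, forall y in R, o_I o x y \in R],
      [forall x in R, o_H o x \in R],
      [forall x in R, forall y in R, forall z in R, o_N0 o x y z \in R],
      [forall x in R, forall y in R, forall z in R, o_S o x y z \in R],
      [forall u in R, forall x in R, forall y in R, forall z in R,
        o_Ndot o u x y z \in R] &
      [forall u in R, forall v in R, forall x in R, forall y in R,
        o_P o u v x y \in R]].

Definition generated (U : finType) (o : ops U) (G : {set U}) : {set U} :=
  \bigcap_(R : {set U} | subuniverse o R && (G \subset R)) R.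

Section Relations.
Variables (n : nat) (T : finType).
Implicit Types (a : {ffun T -> elt n}) (R : {set {ffun T -> elt n}}).

Definition proj (J : {set T}) a : {ffun {i : T | i \in J} -> elt n} :=
  [ffun i => a (val i)].
Definition projs (J : {set T}) R : {set {ffun {i : T | i \in J} -> elt n}} :=
  [set proj J a | a in R].

(* a(J) \in R(J) for J = [m] \ {i} *)
Definition in_without (i : T) a R : Prop :=
  proj [set~ i] a \in projs [set~ i] R.

Definition synchronized a : Prop := forall i j : T, State (a i) = State (a j).

Definition computational R : Prop :=
  forall a, a \in R ->
    synchronized a /\ #|[set i : T | a i \in setD_]| <= 1.

Definition halting R : Prop :=
  exists r, [/\ r \in R,
    forall i : T, r i \in [set (st0, Zero); (st0, Dot)] &
    ~ (forall i : T, r i = (st0, Zero))].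

Definition dotpart R : {set T} := [set i | [exists r in R, r i \in setD_]].

Definition inY a : Prop := forall i : T, a i \in setY_.

Definition Ypart R : {set {ffun T -> elt n}} :=
  [set a in R | [forall i, a i \in setY_]].

Definition gen_I (M : machine n) R : {set {ffun T -> elt n}} :=
  generated (power (alg M) T)
    [set o_I (power (alg M) T) a b | a in Ypart R, b in Ypart R].

End Relations.

(* The inherently non-halting part N(R) is an arbitrary fixed choice of a set
   with these properties, so it is rendered as a predicate on [NR]. *)
Record inherent n (T : finType) (kappa : nat) (R : {set {ffun T -> elt n}})
    (NR : {set T}) : Prop := Inherent {
  inherent_nonhalting : ~ halting (projs NR R);
  inherent_card : #|NR :&: dotpart R| <= kappa;
  inherent_meets : dotpart R != set0 -> NR :&: dotpart R != set0;
  inherent_compl : ~: dotpart R \subset NR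
}.

(* Main.v *)
Require Import Defs.
From mathcomp Require Import all_boot.

Set Implicit Arguments.
Unset Strict Implicit.
Unset Printing Implicit Defensive.

(** If some [a] in [R] without crosses had its dot outside [N(R)], then on
    [N(R)] the relation would contain the constant tuple <1,0> (namely
    [I(a, a)]) and, for any [p] in [N(R)] carrying a dot of [r] in [R], the
    tuple [I(r, a)], which is <1,bullet> at [p] and <1,0> elsewhere. A term
    producing <0,bullet> from <1,bullet> and <1,0> then yields a halting tuple
    of [R(N(R))]. Hence all generators of [R_I] are <1,0> outside [N(R)], so the
    elements of [R_I] are constant there with content 0 or a cross. As [alpha]
    has no crosses and its entries at [k] and [l] have the same state, the
    elements of [R_I] that agree with it off [k] and off [l] both equal it. *)

(** * Closure conditions, generated subuniverses and the diagonal *)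

Section Subuniverse.
Variables (U : finType) (o : ops U).
Implicit Types V G : {set U}.

Lemma subuniverseP V :
  reflect
    [/\ [/\ {in V &, forall x y, o_meet o x y \in V},
            {in V &, forall x y, o_M o x y \in V},
            {in V, forall x, o_M' o x \in V} &
            {in V &, forall x y, o_I o x y \in V}],
        {in V, forall x, o_H o x \in V},
        {in V & &, forall x y z, o_N0 o x y z \in V},
        {in V & &, forall x y z, o_S o x y z \in V} &
        (forall u x y z, u \in V -> x \in V -> y \in V -> z \in V ->
           o_Ndot o u x y z \in V) /\
        (forall u v x y, u \in V -> v \in V -> x \in V -> y \in V ->
           o_P o u v x y \in V)]
    (subuniverse o V).
Proof.
apply: (iffP idP).
  case/and5P=> /forall_inP h1 /forall_inP h2 /forall_inP h3 /forall_inP h4.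
  case/and5P=> /forall_inP h5 /forall_inP h6 /forall_inP h7 /forall_inP h8.
  move=> /forall_inP h9; do !split.
  - by move=> x y xV yV; apply: (forall_inP (h1 x xV)).
  - by move=> x y xV yV; apply: (forall_inP (h2 x xV)).
  - by move=> x xV; apply: h3.
  - by move=> x y xV yV; apply: (forall_inP (h4 x xV)).
  - by move=> x xV; apply: h5.
  - move=> x y z xV yV zV.
    exact: (forall_inP (forall_inP (h6 x xV) y yV)).
  - move=> x y z xV yV zV.
    exact: (forall_inP (forall_inP (h7 x xV) y yV)).
  - move=> u x y z uV xV yV zV.
    exact: (forall_inP (forall_inP (forall_inP (h8 u uV) x xV) y yV)).
  - move=> u v x y uV vV xV yV.
    exact: (forall_inP (forall_inP (forall_inP (h9 u uV) v vV) x xV)).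
case=> [[h1 h2 h3 h4] h5 h6 h7 [h8 h9]].
apply/and5P; split.
- by apply/forall_inP=> x xV; apply/forall_inP=> y; apply: h1.
- by apply/forall_inP=> x xV; apply/forall_inP=> y; apply: h2.
- by apply/forall_inP.
- by apply/forall_inP=> x xV; apply/forall_inP=> y; apply: h4.
apply/and5P; split.
- by apply/forall_inP.
- apply/forall_inP=> x xV; apply/forall_inP=> y yV; apply/forall_inP=> z.
  exact: h6.
- apply/forall_inP=> x xV; apply/forall_inP=> y yV; apply/forall_inP=> z.
  exact: h7.
- apply/forall_inP=> u uV; apply/forall_inP=> x xV; apply/forall_inP=> y yV.
  by apply/forall_inP=> z; apply: h8.
- apply/forall_inP=> u uV; apply/forall_inP=> v vV; apply/forall_inP=> x xV.
  by apply/forall_inP=> y; apply: h9.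
Qed.

Lemma generated_subset V G :
  subuniverse o V -> G \subset V -> generated o G \subset V.
Proof. by move=> Vsub GV; apply: bigcap_inf; rewrite Vsub. Qed.

End Subuniverse.

(** Operations act coordinatewise, so equal inputs at [k] and [l] give equal outputs there, and
    these stay in [V]. This bounds $R_I$ through its generators. *)
Lemma subuniverse_diag (U : finType) (o : ops U) (T : finType) (k l : T)
    (V : {set U}) :
  subuniverse o V ->
  subuniverse (power o T) [set w : {ffun T -> U} | (w k == w l) && (w k \in V)].
Proof.
case/subuniverseP=> [[h1 h2 h3 h4] h5 h6 h7 [h8 h9]].
apply/subuniverseP; do !split.
- move=> x y; rewrite !inE !ffunE => /andP[/eqP<- ?] /andP[/eqP<- ?].
  by rewrite eqxx h1.
- move=> x y; rewrite !inE !ffunE => /andP[/eqP<- ?] /andP[/eqP<- ?].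
  by rewrite eqxx h2.
- by move=> x; rewrite !inE !ffunE => /andP[/eqP<- ?]; rewrite eqxx h3.
- move=> x y; rewrite !inE !ffunE => /andP[/eqP<- ?] /andP[/eqP<- ?].
  by rewrite eqxx h4.
- by move=> x; rewrite !inE !ffunE => /andP[/eqP<- ?]; rewrite eqxx h5.
- move=> x y z; rewrite !inE !ffunE.
  by move=> /andP[/eqP<- ?] /andP[/eqP<- ?] /andP[/eqP<- ?]; rewrite eqxx h6.
- move=> x y z; rewrite !inE !ffunE.
  by move=> /andP[/eqP<- ?] /andP[/eqP<- ?] /andP[/eqP<- ?]; rewrite eqxx h7.
- move=> u x y z; rewrite !inE !ffunE.
  move=> /andP[/eqP<- ?] /andP[/eqP<- ?] /andP[/eqP<- ?] /andP[/eqP<- ?].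
  by rewrite eqxx h8.
- move=> u v x y; rewrite !inE !ffunE.
  move=> /andP[/eqP<- ?] /andP[/eqP<- ?] /andP[/eqP<- ?] /andP[/eqP<- ?].
  by rewrite eqxx h9.
Qed.

(** * Contents 0 and cross in the machine algebra *)

Section MachineAlgebra.
Variables (n : nat) (M : machine n).

(** Without a dot among its arguments, $M$ only copies the content of two equal arguments or returns
    a cross, and $I$ returns no dot; the other operations copy an argument, keep its content, or
    produce 0 or a cross. *)
Lemma subuniverse_Zero_Cross :
  subuniverse (alg M) [set x | Content x \in [:: Zero; Cross]].
Proof.
apply/subuniverseP; do !split.
- by move=> x y; rewrite !inE /= /op_meet; case: ifP.
- move=> [i c] [j d]; rewrite !inE /= /op_M /=.
  case: ifP => // _; case: (instr_at _ _) => [[? r ?|? r ? ?]|] //.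
    by case: c => //; case: d => //= *; case: ifP.
  by case: c => //; case: d => //= *; case: ifP.
- move=> [i c]; rewrite !inE /= /op_M' /=.
  by case: (instr_at _ _) => [[? r ?|? r ? ?]|] // ?; case: ifP.
- move=> [i c] [j d]; rewrite !inE /= /op_I !inE.
  by case: c => // _ _; case: ifP.
- by move=> x; rewrite !inE /= /op_H; case: ifP.
- move=> x y z; rewrite !inE /= /op_N0 => _ yV zV.
  by do 2![case: ifP => // _].
- by move=> x y z; rewrite !inE /= /op_S; case: ifP.
- move=> u x y z; rewrite !inE /= /op_Ndot => _ xV yV zV.
  by do 4![case: ifP => // _].
- by move=> u v x y; rewrite !inE /= /op_P; case: ifP.
Qed.

Lemma op_M_Cross x y : Content x = Cross \/ Content y = Cross ->
  Content (op_M M x y) = Cross.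
Proof.
case: x y => [i c] [j d] /= h; rewrite /op_M /=; case: ifP => // _.
case: (instr_at _ _) => [[? r ?|? r ? ?]|] //.
  case: h => ->; first by rewrite /=; case: ifP.
  by rewrite !andbF /=; case: ifP => // /andP[/eqP[_ ->]].
case: h => ->; first by rewrite /=; case: ifP.
by rewrite !andbF /=; case: ifP => // /andP[/eqP[_ ->]].
Qed.

(** * Lifting elements of the algebra to tuples of [R] *)

Section Lift.
Variables (T : finType) (R : {set {ffun T -> elt n}}) (J : {set T}) (p : T).
Hypothesis Rsub : subuniverse (power (alg M) T) R.

(** Coordinates outside [J] are left free: only the projection to [J] has to halt, and a lift of
    $\langle 0,\bullet\rangle$ with [p] in [J] makes it do so. *)
Definition zero_lift (x : elt n) (w : {ffun T -> elt n}) : bool :=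
  [&& w \in R, w p == x &
      [forall i in J, (i != p) ==> (w i == (State x, Zero))]].

Lemma zero_liftP x w :
  reflect [/\ w \in R, w p = x &
             forall i, i \in J -> i != p -> w i = (State x, Zero)]
          (zero_lift x w).
Proof.
apply: (iffP and3P) => [[wR /eqP wp /forall_inP h]|[wR wp h]]; split=> //.
- by move=> i iJ ip; apply/eqP; move: (h i iJ); rewrite ip.
- exact/eqP.
- by apply/forall_inP=> i iJ; apply/implyP=> ip; rewrite h.
Qed.

Definition zero_liftable : {set elt n} :=
  [set x | (Content x == Cross) || [exists w, zero_lift x w]].

Lemma zero_liftableI x : x \in zero_liftable -> Content x != Cross ->
  exists w, zero_lift x w.
Proof. by rewrite inE => /orP[->//|/existsP]. Qed.

(* An operation returns a non-cross only when it copies an argument, returns one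
   of the two generators, or has non-cross arguments and maps 0s to 0. *)
Lemma subuniverse_zero_liftable :
  (st1, Dot) \in zero_liftable -> (st1, Zero) \in zero_liftable ->
  subuniverse (alg M) zero_liftable.
Proof.
move=> liftD lift0.
have crossW i : (i, Cross) \in zero_liftable by rewrite inE eqxx.
case/subuniverseP: (Rsub) => [[_ RM RM' _] RH _ _ _].
have liftM x y : x \in zero_liftable -> y \in zero_liftable ->
    Content x != Cross -> Content y != Cross -> State x = State y ->
    (forall i, op_M M (i, Zero) (i, Zero) =
       (State (op_M M (i, x.2) (i, y.2)), Zero) \/
       Content (op_M M (i, x.2) (i, y.2)) = Cross) ->
    op_M M x y \in zero_liftable.
  move=> xW yW xX yX sxy hM; rewrite inE.
  case: eqP => //= neX.
  have [w /zero_liftP[wR wp wJ]] := zero_liftableI xW xX.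
  have [v /zero_liftP[vR vp vJ]] := zero_liftableI yW yX.
  apply/existsP; exists (o_M (power (alg M) T) w v).
  apply/zero_liftP; split; first exact: RM.
    by rewrite ffunE wp vp.
  move=> i iJ ip; rewrite ffunE /= wJ // vJ // -sxy.
  case: x y {xW yW xX yX wJ vJ wp vp} sxy hM neX => [s c] [t d] /= <- hM neX.
  by case: (hM s).
apply/subuniverseP; do !split.
- by move=> x y xW yW; rewrite /= /op_meet; case: ifP.
- move=> x y xW yW /=.
  have [sxy|nsxy] := eqVneq (State x) (State y); last first.
    by rewrite /op_M nsxy /toX.
  have [xX|xX] := eqVneq (Content x) Cross.
    by rewrite inE op_M_Cross ?eqxx; last by left.
  have [yX|yX] := eqVneq (Content y) Cross.
    by rewrite inE op_M_Cross ?eqxx; last by right.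
  (* Two equal 0s fall under the case $x=y$ of $M$, which keeps content 0 and moves to the same
     state $j$ as every other case of that instruction. *)
  apply: liftM => // i; rewrite /op_M /= eqxx /=.
  case: (instr_at _ _) => [[? r ?|? r ? ?]|] /=; last by right.
    by rewrite !eqxx /=; do 3![case: ifP => _; first by left]; right.
  by rewrite !eqxx /=; do 3![case: ifP => _; first by left]; right.
- move=> x xW; rewrite inE; case: eqP => //= neX.
  have xX : Content x != Cross.
    apply/eqP=> xX; apply: neX; rewrite /op_M' xX.
    by case: (instr_at _ _) => [[]|].
  have [w /zero_liftP[wR wp wJ]] := zero_liftableI xW xX.
  apply/existsP; exists (o_M' (power (alg M) T) w).
  apply/zero_liftP; split; first exact: RM'.
    by rewrite ffunE wp.
  (* Content 0 is never the tested register, so $M'$ keeps it and moves to the same state $k$ as at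
     [p]. *)
  move=> i iJ ip; rewrite ffunE /= wJ //.
  move: neX; rewrite /op_M' /=.
  by case: (instr_at _ _) => [[? r ?|? r ? ?]|] //=; case: ifP.
- move=> x y _ _ /=; rewrite /op_I; case: ifP => // _; by case: ifP.
- move=> x xW /=; rewrite /op_H; case: ifP => // /orP hx.
  have xX : Content x != Cross by case: hx => /eqP->.
  have [w /zero_liftP[wR wp wJ]] := zero_liftableI xW xX.
  rewrite inE; apply/existsP; exists (o_H (power (alg M) T) w).
  apply/zero_liftP; split; first exact: RH.
    by rewrite ffunE wp /= /op_H; case: hx => ->; rewrite ?orbT.
  move=> i iJ ip; rewrite ffunE /= wJ //.
  by case: hx => /eqP->; rewrite /op_H eqxx.
- move=> x y z xW yW zW /=; rewrite /op_N0.
  by do 2![case: ifP => // _]; rewrite /toX.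
- by move=> x y z _ _ _ /=; rewrite /op_S; case: ifP.
- move=> u x y z uW xW yW zW /=; rewrite /op_Ndot.
  by do 4![case: ifP => // _]; rewrite /toX.
- by move=> u v x y uW vW xW yW /=; rewrite /op_P; case: ifP.
Qed.

Lemma halting_projs w v :
  (st0, Dot) \in generated (alg M) [set (st1, Dot); (st1, Zero)] ->
  p \in J -> zero_lift (st1, Dot) w -> zero_lift (st1, Zero) v ->
  halting (projs J R).
Proof.
move=> hgen pJ wD v0.
have lD : (st1, Dot) \in zero_liftable.
  by rewrite inE; apply/orP; right; apply/existsP; exists w.
have l0 : (st1, Zero) \in zero_liftable.
  by rewrite inE; apply/orP; right; apply/existsP; exists v.
have sG : [set (st1, Dot); (st1, Zero)] \subset zero_liftable.
  by apply/subsetP=> x /set2P[]->.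
(* No explicit term is needed: the liftable elements form a subuniverse containing both generators,
   hence also $\langle 0,\bullet\rangle$. *)
have := subsetP (generated_subset (subuniverse_zero_liftable lD l0) sG) _ hgen.
case/zero_liftableI=> // r /zero_liftP[rR rp rJ].
exists (proj J r); split; first exact: imset_f.
- case=> i iJ; rewrite ffunE /=.
  have [->|ip] := eqVneq i p; first by rewrite rp !inE eqxx orbT.
  by rewrite rJ // !inE eqxx.
- by move/(_ (exist _ p pJ)); rewrite ffunE /= rp.
Qed.

End Lift.

(** * Position of the dots, and the shape of $R_I$ outside $\mathcal{N}(R)$ *)

Lemma computational_dot_inj (T : finType) (R : {set {ffun T -> elt n}}) a i j :
  computational R -> a \in R -> a i \in setD_ -> a j \in setD_ -> i = j.
Proof.
move=> hcomp /hcomp[_ /card_le1P h] ai aj.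
rewrite !inE in ai aj; have := h i; rewrite !inE => /(_ ai j).
by rewrite !inE aj => /esym/eqP.
Qed.

Lemma Ypart_dot_inherent (T : finType) (kappa : nat)
    (R : {set {ffun T -> elt n}}) (NR : {set T}) a q :
  (st0, Dot) \in generated (alg M) [set (st1, Dot); (st1, Zero)] ->
  subuniverse (power (alg M) T) R -> computational R -> inherent kappa R NR ->
  a \in Ypart R -> a q \in setD_ -> q \in NR.
Proof.
move=> hgen hR hcomp [nhalt _ hmeet _]; rewrite inE => /andP[aR /forallP aY] aq.
apply/negPn/negP=> qN; apply: nhalt.
have /set0Pn[p] : NR :&: dotpart R != set0.
  apply: hmeet; apply/set0Pn; exists q.
  by rewrite inE; apply/exists_inP; exists a.
rewrite in_setI inE => /andP[pN /exists_inP[r rR rp]].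
case/subuniverseP: (hR) => [[_ _ _ RI] _ _ _ _].
(* The only dot of [a] is at [q], outside [NR], and [a] has no crosses; so on [NR] its entries lie
   in $C$ and the second case of $I$ applies. *)
have aC i : i \in NR -> a i \notin setD_ /\ a i \in setC_.
  move=> iN; have aiD : a i \notin setD_.
    apply: contra qN => ai.
    by rewrite -(computational_dot_inj hcomp aR ai aq).
  by split=> //; move: (aY i) aiD; rewrite !inE negb_or => -> ->.
apply: (@halting_projs T R NR p hR (o_I (power (alg M) T) r a)
          (o_I (power (alg M) T) a a)) => //.
- apply/zero_liftP; split; first exact: RI.
    by rewrite ffunE /= /op_I rp.
  move=> i iN ip; rewrite ffunE /= /op_I; case: ifP => [ri|_].
    by rewrite (computational_dot_inj hcomp rR ri rp) eqxx in ip.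
  by case: (aC i iN) => _ ->.
- apply/zero_liftP; split; first exact: RI.
    by rewrite ffunE /= /op_I; case: (aC p pN) => /negbTE-> ->.
  by move=> i iN _; rewrite ffunE /= /op_I; case: (aC i iN) => /negbTE-> ->.
Qed.

(** Outside [NR] the generators of $R_I$ are built from entries that are neither dots nor crosses,
    so they equal $\langle 1,0\rangle$ at both [k] and [l]; the diagonal over contents 0 and cross
    is a subuniverse containing them. *)
Lemma gen_I_diag (T : finType) (kappa : nat)
    (R : {set {ffun T -> elt n}}) (NR : {set T}) k l w :
  (st0, Dot) \in generated (alg M) [set (st1, Dot); (st1, Zero)] ->
  subuniverse (power (alg M) T) R -> computational R -> inherent kappa R NR ->
  k \notin NR -> l \notin NR -> w \in gen_I M R ->
  w k = w l /\ Content (w k) \in [:: Zero; Cross].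
Proof.
move=> hgen hR hcomp hN kN lN wI.
have I1 a b i : a \in Ypart R -> b \in Ypart R -> i \notin NR ->
    op_I (a i) (b i) = (st1, Zero).
  move=> aY bY iN.
  have nD c : c \in Ypart R -> c i \notin setD_.
    move=> cY; apply: contra iN.
    exact: (Ypart_dot_inherent hgen hR hcomp hN cY).
  rewrite /op_I (negbTE (nD a aY)).
  move: (nD b bY) (bY); rewrite [b \in _]inE => biD /andP[_ /forallP/(_ i)].
  by move: biD; rewrite !inE => /negbTE-> /negbTE->.
have sG : [set o_I (power (alg M) T) a b | a in Ypart R, b in Ypart R]
    \subset [set w : {ffun T -> elt n} |
          (w k == w l) && (w k \in [set x | Content x \in [:: Zero; Cross]])].
  by apply/subsetP=> _ /imset2P[a b aY bY ->]; rewrite !inE !ffunE /= !I1 ?eqxx.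
have := subsetP (generated_subset
  (subuniverse_diag k l subuniverse_Zero_Cross) sG) w wI.
by rewrite 2!inE => /andP[/eqP ? ?].
Qed.

Lemma in_withoutP (T : finType) (i : T) (a : {ffun T -> elt n}) R :
  in_without i a R -> exists2 w, w \in R & forall j, j != i -> w j = a j.
Proof.
case/imsetP=> w wR eq_aw; exists w => // j ji.
have jP : j \in [set~ i] by rewrite !inE.
by move/ffunP/(_ (exist _ j jP)): eq_aw; rewrite !ffunE.
Qed.

End MachineAlgebra.

(** * Recovering [alpha] from its two approximations in $R_I$ *)

Theorem theorem8p6 (n : nat) (M : machine n) (kappa : nat)
  (hM : standing M kappa)
  (hgen : (st0, Dot) \in generated (alg M) [set (st1, Dot); (st1, Zero)])
  (m : nat) (R : {set {ffun 'I_m -> elt n}})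
  (hR : subuniverse (power (alg M) 'I_m) R)
  (hcomp : computational R) (hnonhalt : ~ halting R)
  (NR : {set 'I_m}) (hNR : inherent kappa R NR)
  (alpha : {ffun 'I_m -> elt n}) (hY : inY alpha)
  (halpha : forall i : 'I_m, in_without i alpha R)
  (k l : 'I_m) (hkl : k <> l) (hk : k \notin NR) (hl : l \notin NR)
  (hkI : in_without k alpha (gen_I M R))
  (hlI : in_without l alpha (gen_I M R)) :
  alpha \in gen_I M R.
Proof.
have [w wI wE] := in_withoutP hkI.
have [v vI vE] := in_withoutP hlI.
have lk : l != k by apply/eqP=> /esym.
have kl : k != l by apply/eqP.
have [wkl cw] := gen_I_diag hgen hR hcomp hNR hk hl wI.
have [vkl cv] := gen_I_diag hgen hR hcomp hNR hk hl vI.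
case/subuniverseP: (hR) => [[_ _ _ RI] _ _ _ _].
have gen_IR u : u \in gen_I M R -> u \in R.
  apply/subsetP/generated_subset => //.
  apply/subsetP=> _ /imset2P[a b aY bY ->].
  move: aY bY; rewrite 2!inE => /andP[aR _] /andP[bR _].
  by apply: RI.
(* A third coordinate, at which both [w] and [v] agree with [alpha]. It exists because [k], lying
   outside [NR], shows that $\mathcal{D}(R)$ is nonempty. *)
have [p pN] : exists p, p \in NR.
  have kD : k \in dotpart R.
    apply: contraNT hk => kD; apply: (subsetP (inherent_compl hNR)).
    by rewrite in_setC.
  have /set0Pn[p] : NR :&: dotpart R != set0.
    by apply: (inherent_meets hNR); apply/set0Pn; exists k.
  by rewrite in_setI => /andP[]; exists p.
have pk : p != k by apply: contraNneq hk => <-.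
have pl : p != l by apply: contraNneq hl => <-.
(* [v] is correct at [k] and [p], [w] at [l] and [p]; both are synchronized, so both states equal
   that of [alpha] at [p]. *)
have sync : State (alpha k) = State (alpha l).
  rewrite -(vE k kl) -(wE l lk).
  have [vS _] := hcomp v (gen_IR v vI).
  have [wS _] := hcomp w (gen_IR w wI).
  by rewrite (vS k p) (wS l p) wE // vE.
rewrite wkl wE // in cw; rewrite vE // in cv.
have zero i : Content (alpha i) \in [:: Zero; Cross] ->
    Content (alpha i) = Zero.
  by move: (hY i); rewrite !inE => /negbTE-> /orP[/eqP|].
(* Only coordinate [k] is in doubt: there [w] takes the value [alpha l], which has the same state
   and the same content 0 as [alpha k]. *)
suff -> : alpha = w by [].
apply/ffunP=> i; have [->|ik] := eqVneq i k; last by rewrite wE.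
rewrite wkl wE //; move: sync (zero k cv) (zero l cw).
by case: (alpha k) (alpha l) => [s c] [t d] /= -> -> ->.
Qed.
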